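(* $\mathfrak{ros}_{01}=\mathfrak{r}$.
   Context: $\mathfrak{ros}_{01}$ is the minimal cardinality of a family $\mathcal{G}$ of infinite subsets of $\mathbb{N}$ (a binary Rosenthal family) such that for every function $f:\mathbb{N}\to\mathbb{N}$ with no fixed points there is $A\in\mathcal{G}$ with $f[A]\cap A=\emptyset$. The reaping number $\mathfrak{r}$ is the minimal cardinality of a family $\mathcal{F}$ of infinite subsets of $\mathbb{N}$ such that there is no $S\subseteq\mathbb{N}$ with $F\cap S$ and $F\setminus S$ both infinite for all $F\in\mathcal{F}$. *)

(* Defs.v *)
From mathcomp Require Import all_boot.
From mathcomp Require Import boolp classical_sets functions cardinality.

Set Implicit Arguments.
Unset Strict Implicit.
Unset Printing Implicit Defensive.

Local Open Scope classical_set_scope.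
Local Open Scope card_scope.

Definition binary_rosenthal (G : set (set nat)) : Prop :=
  (forall A, G A -> infinite_set A) /\
  (forall f : nat -> nat, (forall n, f n <> n) ->
     exists A, G A /\ f @` A `&` A = set0).

Definition reaping (F : set (set nat)) : Prop :=
  (forall A, F A -> infinite_set A) /\
  ~ (exists S : set nat, forall A, F A ->
       infinite_set (A `&` S) /\ infinite_set (A `\` S)).

Definition has_least_card (T : Type) (P : set T -> Prop) (A : set T) : Prop :=
  P A /\ forall B, P B -> A #<= B.

(* There is no type of cardinals in the library: the cardinal
   min {|A| : P A} is represented by a chosen set A of least cardinality
   satisfying P, and equality of cardinals is equipotence, #=. The choice is
   irrelevant up to #= (has_least_card_eq), and [get] never returns its default
   value when some set satisfies P (min_cardP). *)
Definition min_card (T : Type) (P : set T -> Prop) : set T :=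
  get [set A | has_least_card P A].

Definition ros01 : set (set nat) := min_card binary_rosenthal.

Definition reaping_number : set (set nat) := min_card reaping.

Lemma has_least_card_eq (T : Type) (P : set T -> Prop) (A B : set T) :
  has_least_card P A -> has_least_card P B -> A #= B.
Proof.
move=> [PA lA] [PB lB]; rewrite card_eq_le.
by apply/andP; split; [exact: lA | exact: lB].
Qed.

(* Cardinals are well-ordered: a maximal family of choice functions on P that
   pairwise differ at every coordinate is onto some coordinate. *)
Lemma has_least_card_ex (T : pointedType) (P : set T -> Prop) :
  (exists A, P A) -> exists A, has_least_card P A.
Proof.
move=> [A0 PA0].
pose Q (F : set (set T -> T)) :=
  (forall f A, F f -> P A -> A (f A)) /\
  (forall f g A, F f -> F g -> P A -> f A = g A -> f = g).
have [|F [[Fc Fi] Fmax]] := @Zorn_bigcup _ Q.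
  move=> C CQ Ctot; split=> [f A [X CX Xf] PA|f g A [X CX Xf] [Y CY Yg] PA fgA].
    exact: (CQ _ CX).1 Xf PA.
  have [XY|YX] := Ctot _ _ CX CY.
    exact: (CQ _ CY).2 (XY _ Xf) Yg PA fgA.
  exact: (CQ _ CX).2 Xf (YX _ Yg) PA fgA.
have [[A PA AF]|noA] :=
    pselect (exists2 A, P A & A `<=` [set f A | f in F]).
  exists A; split=> // B PB.
  apply: (card_le_trans (subset_card_le AF)).
  apply: (card_le_trans (card_image_le (fun f : set T -> T => f A) F)).
  have injB : {in F &, injective (fun f : set T -> T => f B)}.
    by move=> f g /set_mem Ff /set_mem Fg; exact: Fi _ _ B Ff Fg PB.
  rewrite -(card_le_eql (inj_card_eq injB)).
  by apply: subset_card_le => _ [f Ff <-]; exact: Fc _ _ Ff PB.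
have /choice[h hP] : forall A, exists a, P A -> A a /\ forall f, F f -> f A <> a.
  move=> A; apply: contrapT => /forallNP nA.
  have PA : P A by apply: contrapT => nPA; apply: (nA point).
  apply: noA; exists A => // a Aa; apply: contrapT => na.
  by apply: (nA a) => _; split=> // f Ff fa; apply: na; exists f.
have [] := Fmax (F `|` [set h]).
- split; first by move=> f Ff; left.
  by move=> /(_ h (or_intror erefl)) Fh; exact: ((hP _ PA0).2 _ Fh).
- split=> [f A [Ff|->] PA|f g A [Ff|->] [Fg|->] PA].
  + exact: Fc _ _ Ff PA.
  + exact: (hP _ PA).1.
  + exact: Fi _ _ A Ff Fg PA.
  + by move=> e; have := (hP _ PA).2 _ Ff.
  + by move=> e; have := (hP _ PA).2 _ Fg; rewrite e.
  + by [].
Qed.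

Lemma min_cardP (T : pointedType) (P : set T -> Prop) :
  (exists A, P A) -> has_least_card P (min_card P).
Proof. by move=> /has_least_card_ex/getPex. Qed.

Lemma binary_rosenthal_ex : exists G, binary_rosenthal G.
Proof.
exists [set A | infinite_set A]; split=> // f fN.
have [[m fm]|ffin] := pselect (exists m, infinite_set (f @^-1` [set m])).
  exists (f @^-1` [set m] `\` [set m]); split.
    by apply: infinite_setD => //; exact: finite_set1.
  by rewrite -subset0 => _ [[x [-> _] <-] [_ /(_ erefl)]].
have [|A [AA Amax]] := @Zorn_bigcup _ [set A | f @` A `&` A = set0].
  move=> C CQ Ctot; rewrite /= -subset0 => y [[x [X CX Xx] fx] [Y CY Yy]].
  have [XY|YX] := Ctot _ _ CX CY.
    by rewrite -[set0](CQ _ CY); split=> //; exists x => //; exact: XY.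
  by rewrite -[set0](CQ _ CX); split; [exists x | exact: YX].
exists A; split=> // finA.
have finU : finite_set (A `|` f @` A `|` f @^-1` A).
  rewrite !finite_setU; do ?split=> //; first exact: finite_image.
  have -> : f @^-1` A = \bigcup_(i in A) f @^-1` [set i].
    apply/seteqP; split=> [x Ax|x [i Ai fxi]]; first by exists (f x).
    by rewrite /preimage /= fxi.
  by apply: bigcup_finite => // i _; apply: contrapT => ?; apply: ffin; exists i.
have /infinite_setN0[n [_ /not_orP[/not_orP[nA nfA] nfpA]]] :=
  infinite_setD infinite_nat finU.
apply: (Amax (A `|` [set n])).
  by split=> [x|/(_ n (or_intror erefl))//]; left.
rewrite /= -subset0 => y [[x [Ax|->] <-] []].
- by move=> Afx; rewrite -[set0]AA; split=> //; exists x.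
- by move=> fxn; apply: nfA; exists x.
- by [].
- exact: fN.
Qed.

Lemma reaping_ex : exists F, reaping F.
Proof.
exists [set A | infinite_set A]; split=> // -[S SP].
have [finS|infS] := pselect (finite_set S).
  have [+ _] := SP _ infinite_nat; apply.
  by rewrite setTI.
by have [_] := SP _ infS; rewrite setDv; apply; exact: finite_set0.
Qed.

Lemma ros01P : has_least_card binary_rosenthal ros01.
Proof. exact: min_cardP binary_rosenthal_ex. Qed.

Lemma reaping_numberP : has_least_card reaping reaping_number.
Proof. exact: min_cardP reaping_ex. Qed.

(* Main.v *)
(* [r <= ros01]: let G be binary Rosenthal and suppose that no family {h A : A in G}
   of infinite sets is reaping. Then one finds S_0 splitting G, S_1 splitting
   {A /\ S_0 : A in G}, and so on. Let f n be the least k with n outside S_k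
   (or any other value if this k is n). Every A in G contains some k, and
   (A /\ S_0 /\ ... /\ S_(k-1)) \ S_k contains some n <> k, so f n = k lies in
   both f[A] and A: contradiction.

   [ros01 <= r]: if f has no fixed points, two binary colourings of nat suffice
   to separate every n from f n. Given a reaping family F, some A in F is almost
   constant for the first colouring and, after transporting F to A along an
   enumeration e_A, some e_A[B] with B in F is almost constant for both. The sets
   e_A[B] minus a finite initial segment form a family of cardinality at most
   |F * F * nat| = |F|, because F is infinite. *)
Require Import Defs.
From mathcomp Require Import all_boot.
From mathcomp Require Import boolp classical_sets functions cardinality.

Set Implicit Arguments.
Unset Strict Implicit.
Unset Printing Implicit Defensive.

Local Open Scope classical_set_scope.
Local Open Scope card_scope.

(** * Cardinal arithmetic: comparability, and squares of infinite sets *)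

Lemma card_le_fun (T : Type) (U : pointedType) (A : set T) (B : set U) :
  A #<= B <-> exists f : T -> U, (forall x, A x -> B (f x)) /\
    (forall x y, A x -> A y -> f x = f y -> x = y).
Proof.
split=> [/pcard_leP[f]|[f [fAB finj]]].
  exists f; split=> [x Ax|x y Ax Ay]; first exact: funS.
  by apply: inj; rewrite inE.
have injf : {in A &, injective f}.
  by move=> x y /set_mem Ax /set_mem Ay; exact: finj.
rewrite -(card_le_eql (inj_card_eq injf)).
by apply: subset_card_le => _ [x Ax <-]; exact: fAB.
Qed.

(** The family consisting of [A] and [B] has a member of least cardinality. *)
Lemma card_le_total (T : pointedType) (A B : set T) : A #<= B \/ B #<= A.
Proof.
have [|C [[->|->] leC]] :=
    @has_least_card_ex _ (fun C : set T => C = A \/ C = B).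
- by exists A; left.
- by left; apply: leC; right.
- by right; apply: leC; left.
Qed.

(* [p.2] is an injection from [p.1 `*` p.1] to [p.1]; a pairing that is maximal
   for extension has a support as large as [A]. *)
Definition pairing (T : pointedType) (A : set T) (p : set T * (T -> T -> T)) :=
  [/\ infinite_set p.1, p.1 `<=` A,
      forall x y, p.1 x -> p.1 y -> p.1 (p.2 x y) &
      forall x y x' y', p.1 x -> p.1 y -> p.1 x' -> p.1 y' ->
        p.2 x y = p.2 x' y' -> x = x' /\ y = y'].

Definition pairing_le (T : Type) (p q : set T * (T -> T -> T)) :=
  p.1 `<=` q.1 /\ forall x y, p.1 x -> p.1 y -> p.2 x y = q.2 x y.

Lemma pairing_le_trans (T : Type) (p q r : set T * (T -> T -> T)) :
  pairing_le p q -> pairing_le q r -> pairing_le p r.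
Proof.
move=> [pq epq] [qr eqr]; split; first exact: subset_trans qr.
by move=> x y px py; rewrite epq// eqr//; exact: pq.
Qed.

(** The starting point for Zorn's lemma: a countably infinite subset of [A] injects its own
    square. *)
Lemma pairing_ex (T : pointedType) (A : set T) :
  infinite_set A -> exists p, pairing A p.
Proof.
move=> /infiniteP/card_le_fun[e [eA einj]].
have injX : [set: nat] #<= range e.
  by apply/card_le_fun; exists e; split=> // n _; exists n.
have cX : countable (range e) by exact: (card_le_trans (card_image_le _ _)).
have /card_le_fun[c [cin cinj]] :=
  card_le_trans (countableX cX cX) injX.
exists (range e, fun x y => c (x, y)); split => /=.
- exact/infiniteP.
- by move=> _ [n _ <-]; exact: eA.
- by move=> x y Xx Xy; exact: cin.
- move=> x y x' y' Xx Xy Xx' Xy'.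
  by case/(cinj (x, y) (x', y') (conj Xx Xy) (conj Xx' Xy')).
Qed.

(** Supports are united and maps glued. Any four points of the union lie in one support, so
    injectivity is inherited from a member of the chain. *)
Lemma pairing_chain (T : pointedType) (A : set T)
    (C : set (set T * (T -> T -> T))) :
  C !=set0 -> C `<=` pairing A ->
  (forall p q, C p -> C q -> pairing_le p q \/ pairing_le q p) ->
  exists2 p, pairing A p & forall q, C q -> pairing_le q p.
Proof.
move=> [p0 Cp0] Cpair Ctot.
pose X := \bigcup_(p in C) p.1.
have common x y x' y' : X x -> X y -> X x' -> X y' ->
    exists2 p, C p & [/\ p.1 x, p.1 y, p.1 x' & p.1 y'].
  have join p q : C p -> C q -> exists2 r, C r & p.1 `<=` r.1 /\ q.1 `<=` r.1.
    by move=> Cp Cq; have [[pq _]|[qp _]] := Ctot _ _ Cp Cq;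
      [exists q => //; split|exists p => //; split].
  move=> [p Cp px] [q Cq qy] [p' Cp' px'] [q' Cq' qy'].
  have [r Cr [pr qr]] := join _ _ Cp Cq.
  have [r' Cr' [pr' qr']] := join _ _ Cp' Cq'.
  have [s Cs [rs rs']] := join _ _ Cr Cr'.
  by exists s => //; split; [apply/rs/pr|apply/rs/qr|apply/rs'/pr'|apply/rs'/qr'].
have /choice[c cP] : forall xy, exists z, forall p, C p ->
    p.1 xy.1 -> p.1 xy.2 -> z = p.2 xy.1 xy.2.
  move=> [x y] /=.
  have [[p Cp [px py]]|no] := pselect (exists2 p, C p & p.1 x /\ p.1 y); last first.
    by exists point => p Cp px py; case: no; exists p.
  exists (p.2 x y) => q Cq qx qy.
  by have [[_ ->]|[_ ->]] := Ctot _ _ Cp Cq.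
exists (X, fun x y => c (x, y)); last first.
  move=> q Cq; split=> [x qx|x y qx qy] /=; first by exists q.
  by rewrite (cP (x, y) q).
split=> /=.
- have [inf _ _ _] := Cpair _ Cp0.
  by apply: sub_infinite_set inf => x p0x; exists p0.
- by move=> x [p Cp px]; have [_ sub _ _] := Cpair _ Cp; exact: sub.
- move=> x y Xx Xy; have [p Cp [px py _ _]] := common x y x y Xx Xy Xx Xy.
  have [_ _ pin _] := Cpair _ Cp.
  by rewrite (cP (x, y) p)//; exists p => //; exact: pin.
- move=> x y x' y' Xx Xy Xx' Xy'.
  have [p Cp [px py px' py']] := common _ _ _ _ Xx Xy Xx' Xy'.
  have [_ _ _ pinj] := Cpair _ Cp.
  by rewrite (cP (x, y) p)// (cP (x', y') p)//; exact: pinj.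
Qed.

(** Two distinct points [x0], [x1] of the support give disjoint copies [c x0 _] and [c x1 _] of it
    inside itself: one receives the part of [Z] in the support, the other the rest. *)
Lemma pairing_absorb (T : pointedType) (A : set T) p (Z : set T) :
  pairing A p -> Z `\` p.1 #<= p.1 -> Z #<= p.1.
Proof.
case: p => X c [/= Xinf XA cin cinj] /card_le_fun[h [hX hinj]].
have [x0 Xx0] := infinite_setN0 Xinf.
have [x1 [Xx1 x10]] := infinite_setN0 (infinite_setD Xinf (finite_set1 x0)).
apply/card_le_fun.
exists (fun z => if `[< X z >] then c x0 z else c x1 (h z)); split.
  move=> z Zz; case: asboolP => Xz; apply: cin => //.
  exact: hX.
move=> z z' Zz Zz'; case: asboolP => Xz; case: asboolP => Xz' e.
- by have [] := cinj _ _ _ _ Xx0 Xz Xx0 Xz' e.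
- have [e' _] := cinj _ _ _ _ Xx0 Xz Xx1 (hX _ (conj Zz' Xz')) e.
  by case: x10.
- have [e' _] := cinj _ _ _ _ Xx1 (hX _ (conj Zz Xz)) Xx0 Xz' e.
  by case: x10.
- have [_] := cinj _ _ _ _ Xx1 (hX _ (conj Zz Xz)) Xx1 (hX _ (conj Zz' Xz')) e.
  exact: hinj.
Qed.

Lemma pairing_extend (T : pointedType) (A : set T) p :
  pairing A p -> p.1 #<= A `\` p.1 ->
  exists2 q, pairing A q & pairing_le p q /\ ~ (q.1 `<=` p.1).
Proof.
move=> pp /card_le_fun[g [gA ginj]].
pose Z := p.1 `|` g @` p.1.
have /card_le_fun[j [jX jinj]] : Z #<= p.1.
  apply: (pairing_absorb pp); apply: card_le_trans (card_image_le g p.1).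
  by apply: subset_card_le => z [[]].
case: p pp => X c [/= Xinf XA cin cinj] in g gA ginj Z j jX jinj *.
(* Pairs not inside [X] are coded in [X] through [j], then moved out of [X] by [g], so they never
   collide with old values. *)
exists (Z, fun x y => if `[< X x /\ X y >] then c x y else g (c (j x) (j y))).
  split=> /=.
  - by apply: sub_infinite_set Xinf => x; left.
  - by move=> x [/XA//|[y Xy <-]]; exact: (gA _ Xy).1.
  - move=> x y Zx Zy; case: asboolP => [[Xx Xy]|_]; first by left; exact: cin.
    by right; exists (c (j x) (j y)) => //; apply: cin; exact: jX.
  - have cj x y : Z x -> Z y -> X (c (j x) (j y)).
      by move=> Zx Zy; apply: cin; exact: jX.
    move=> x y x' y' Zx Zy Zx' Zy'.
    case: asboolP => [[Xx Xy]|_]; case: asboolP => [[Xx' Xy']|_].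
    + exact: cinj.
    + by move=> e; have := (gA _ (cj _ _ Zx' Zy')).2; rewrite -e; case; exact: cin.
    + by move=> e; have := (gA _ (cj _ _ Zx Zy)).2; rewrite e; case; exact: cin.
    + move=> /ginj -/(_ (cj _ _ Zx Zy) (cj _ _ Zx' Zy')) /cinj[];
        try exact: jX.
      by move=> /jinj -> // /jinj ->.
split; first split=> /= [x|x y Xx Xy]; first by left.
  by case: asboolP => // -[].
have [x0 Xx0] := infinite_setN0 Xinf.
by move=> /(_ (g x0)) gX; apply: (gA _ Xx0).2; apply: gX; right; exists x0.
Qed.

(** If the support of a maximal pairing injected into its complement in [A], the pairing would
    extend. So the complement injects into the support, and by absorption so does [A]. *)
Lemma infinite_card_square (T : pointedType) (A : set T) :
  infinite_set A -> A `*` A #<= A.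
Proof.
move=> /pairing_ex[p0 pp0].
(* A preorder, not an order: pairings may differ off their support. *)
pose R (p q : {p | pairing A p}) := `[< pairing_le (sval p) (sval q) >].
have [|p q r /asboolP pq /asboolP qr|C Ctot|[p pp] pmax] :=
    @ZL_preorder _ (exist _ p0 pp0) R.
- by move=> p; apply/asboolP; split.
- by apply/asboolP; exact: pairing_le_trans qr.
- have [C0|/set0P[p1 Cp1]] := eqVneq C set0.
    by exists (exist _ p0 pp0) => s; rewrite C0.
  have [| | |p pp ub] := @pairing_chain _ A [set sval p | p in C].
  + by exists (sval p1); exists p1.
  + by move=> _ [p _ <-]; exact: (svalP p).
  + move=> _ _ [p Cp <-] [q Cq <-].
    by have [/asboolP|/asboolP] := Ctot _ _ Cp Cq; [left|right].
  + by exists (exist _ p pp) => s Cs; apply/asboolP/ub; exists s.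
have [le|le] := card_le_total (A `\` p.1) p.1; last first.
  have [q qp [pq nqp]] := pairing_extend pp le.
  have /asboolP[/= qp' _] : R (exist _ q qp) (exist _ p pp).
    by apply: pmax; exact/asboolP.
  by [].
have /card_le_fun[j [jX jinj]] := pairing_absorb pp le.
case: p pp {pmax le} => X c [/= Xinf XA cin cinj] in j jX jinj *.
apply/card_le_fun; exists (fun xy => c (j xy.1) (j xy.2)); split.
  by move=> [x y] [/= Ax Ay]; apply/XA/cin; exact: jX.
move=> [x y] [x' y'] [/= Ax Ay] [/= Ax' Ay'] /cinj[]; try exact: jX.
by move=> /jinj -> // /jinj ->.
Qed.

(** * Separating [n] from [f n] by two binary colourings *)

(* The equation [f^i (r n) = f^j n], where [r n] is a representative of the
   component of [n], determines [i - j], since [f] is acyclic; the colour is its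
   parity. *)
Lemma alternating_increasing (f : nat -> nat) : (forall n, n < f n) ->
  exists g : nat -> bool, forall n, g (f n) = ~~ g n.
Proof.
move=> f_incr.
have itS i n : iter i f (f n) = iter i.+1 f n by rewrite iterSr.
have it_lt n : {homo (fun i => iter i f n) : i j / i < j}.
  by apply: homo_ltn => [y x z|i]; [exact: ltn_trans | exact: f_incr].
have it_inj n : injective (fun i => iter i f n).
  exact/incn_inj/leq_mono/it_lt.
pose orbit n := [set m | exists i j, iter i f m = iter j f n].
have orbitf n : orbit (f n) = orbit n.
  apply/seteqP; split=> m [i [j e]].
    by exists i, j.+1; rewrite -itS.
  by exists i.+1, j; rewrite itS /= e.
pose r n := get (orbit n).
have rP n : orbit n (r n) by apply: (@getPex _ (orbit n)); exists n, 0, 0.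
have rf n : r (f n) = r n by rewrite /r orbitf.
have dist n i j i' j' : iter i f (r n) = iter j f n ->
    iter i' f (r n) = iter j' f n -> odd (i + j) = odd (i' + j').
  move=> e e'.
  (* Both sides equal the iterate of order [i + i'] of [f] at [r n]. *)
  have /it_inj E : iter (i' + j) f n = iter (i + j') f n.
    by rewrite !iterD -e -e' -!iterD addnC.
  move/(congr1 odd): E; rewrite !oddD.
  by case: (odd i) (odd j) (odd i') (odd j') => [] [] [] [].
pose g n := `[< exists i j, iter i f (r n) = iter j f n /\ odd (i + j) >].
have gE n i j : iter i f (r n) = iter j f n -> g n = odd (i + j).
  move=> e; apply/asboolP/idP => [[i' [j' [e' o]]]|o].
    by rewrite (dist n i j i' j').
  by exists i, j.
exists g => n; have [i [j e]] := rP n.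
rewrite (gE n i j)// (gE (f n) i.+1 j) ?addSn//.
by rewrite rf itS /= e.
Qed.

Lemma alternating_decreasing (f : nat -> nat) :
  exists g : nat -> bool, forall n, f n < n -> g n = ~~ g (f n).
Proof.
(* The parity of the number of steps before the orbit of [n] stops decreasing; [k] is fuel, and any
   [k > n] suffices. *)
pose fix c (k n : nat) {struct k} : bool :=
  if k is k'.+1 then if f n < n then ~~ c k' (f n) else false else false.
have cE n : forall k k', n < k -> n < k' -> c k n = c k' n.
  elim/ltn_ind: n => n IH [//|k] [//|k'] nk nk' /=.
  case: ifP => // fn; rewrite (IH _ fn k k')//; exact: leq_trans fn _.
exists (fun n => c n.+1 n) => n fn /=.
by rewrite fn (cE (f n) n (f n).+1).
Qed.

(** [b0] tells whether [f] decreases at a point. If it agrees at [n] and [f n], then [b1] uses the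
    same alternating colouring at both, and that colouring changes from [n] to [f n]. *)
Lemma separating_bits (f : nat -> nat) : (forall n, f n <> n) ->
  exists b0 b1 : nat -> bool, forall n, b0 (f n) = b0 n -> b1 (f n) <> b1 n.
Proof.
(* The value [n.+1] where [f] does not increase keeps [f_up] above the identity. *)
move=> fN; pose f_up n := if n < f n then f n else n.+1.
have [|u uP] := @alternating_increasing f_up.
  by move=> n; rewrite /f_up; case: ifP.
have [d dP] := alternating_decreasing f.
exists (fun n => f n < n), (fun n => if f n < n then d n else u n) => n ->.
case: ltnP => [fn|nf]; first by rewrite (dP n)//; case: (d _).
have nfn : n < f n by rewrite ltn_neqAle nf andbT; apply/eqP => /esym; exact: fN.
by have := uP n; rewrite /f_up nfn => ->; case: (u n).
Qed.

(** * Splitting sets and reaping families *)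

(* Pick [x n] increasing, each [A] in [F] being visited infinitely often for each
   of the two values of the bit that decides whether [x n] is put in [S]. *)
Lemma countable_split (F : set (set nat)) :
  countable F -> (forall A, F A -> infinite_set A) ->
  exists S, forall A, F A -> infinite_set (A `&` S) /\ infinite_set (A `\` S).
Proof.
move=> /countable_injP[e einj] Finf.
(* Indices coding no member of [F] get the whole of [nat], so that every [a k] is infinite. *)
pose a k := xget [set: nat] [set A | F A /\ e A = k].
have a_inf k : infinite_set (a k).
  rewrite /a; case: xgetP => [A _ [/Finf//]|_]; exact: infinite_nat.
have aK A : F A -> a (e A) = A.
  move=> FA; rewrite /a; case: xgetP => [B _ [FB eBA]|/(_ A)[]//].
  by apply: einj => //; rewrite inE.
have /choice[p pP] : forall Am : nat * nat, exists n, a Am.1 n /\ Am.2 < n.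
  move=> [k m] /=.
  have [n [an nm]] := infinite_setN0 (infinite_setD (a_inf k) (finite_II m.+1)).
  by exists n; split=> //; rewrite ltnNge; apply/negP => ?; apply: nm.
(* A task is the index of a set, a bit, and a counter that makes each index and bit recur infinitely
   often. *)
have [code [task codeK]] : exists (code : nat * bool * nat -> nat) task,
    cancel code task.
  exists pickle, (fun n => odflt (0, true, 0) (unpickle n)) => t.
  by rewrite pickleK.
pose fix x (n : nat) : nat := p ((task n).1.1, if n is n'.+1 then x n' else 0).
have x_in n : a (task n).1.1 (x n) by case: n => [|n]; exact: (pP (_, _)).1.
have x_lt : {homo x : i j / i < j}.
  apply: homo_ltn => [y i z|i]; first exact: ltn_trans.
  exact: (pP (_, x i)).2.
have x_inj : injective x by exact/incn_inj/leq_mono.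
exists [set x n | n in [set n | (task n).1.2]] => A FA.
have xA b j : A (x (code (e A, b, j))).
  by have := x_in (code (e A, b, j)); rewrite codeK /= aK.
have x_code_inj b : injective (fun j => x (code (e A, b, j))).
  by move=> i j /x_inj /(can_inj codeK) [].
split; apply/infiniteP/card_le_fun.
- exists (fun j => x (code (e A, true, j))); split=> [j _|i j _ _].
    by split; [exact: xA | exists (code (e A, true, j)); rewrite //= codeK].
  exact: x_code_inj.
- exists (fun j => x (code (e A, false, j))); split=> [j _|i j _ _].
    split; first exact: xA.
    by move=> [n /= tn /x_inj E]; move: tn; rewrite E codeK.
  exact: x_code_inj.
Qed.

Lemma reaping_infinite F : reaping F -> infinite_set F.
Proof.
by move=> [Finf Fr] /finite_set_countable cF; apply: Fr; exact: countable_split.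
Qed.

(** Otherwise the set of points of colour [true] would split every member of [F]. *)
Lemma reaping_constant F (b : nat -> bool) : reaping F ->
  exists A v, F A /\ finite_set (A `&` [set n | b n <> v]).
Proof.
move=> [Finf Fr]; apply: contrapT => no; apply: Fr.
exists [set n | b n] => A FA; split=> fin; apply: no.
- exists A, false; split=> //; apply: sub_finite_set fin => n [An /= bn].
  by split=> //=; case: (b n) bn.
- by exists A, true.
Qed.

Lemma finite_nat_bound (A : set nat) : finite_set A ->
  exists n, forall m, A m -> m < n.
Proof.
move=> /finite_seqP[s ->]; exists (\max_(i <- s) i).+1 => m ms.
by rewrite ltnS; exact: (@leq_bigmax_seq _ s xpredT id).
Qed.

(** * From a reaping family to a binary Rosenthal family *)

Lemma binary_rosenthal_of_reaping F : reaping F ->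
  exists2 G, binary_rosenthal G & G #<= F.
Proof.
move=> rF; have Finf := reaping_infinite rF; have [Fmem _] := rF.
have /choice[e eP] : forall A : set nat, exists e : nat -> nat,
    infinite_set A -> (forall n, A (e n)) /\ injective e.
  move=> A; have [/infiniteP/card_le_fun[e [eA einj]]|?] :=
    pselect (infinite_set A); last by exists id.
  by exists e => _; split=> [n|i j]; [exact: eA | exact: einj].
pose g (t : set nat * set nat * nat) := e t.1.1 @` t.1.2 `\` `I_t.2.
exists (g @` (F `*` F `*` [set: nat])).
  split=> [_ [[[A B] n] [[/= FA FB] _] <-]|f fN].
    have [eA einj] := eP _ (Fmem _ FA).
    apply: infinite_setD; last exact: finite_II.
    move=> fin; apply: (Fmem _ FB).
    apply: card_le_finite fin; apply/card_le_fun; exists (e A).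
    by split=> [k Bk|i j _ _ /einj//]; exists k.
  have [b0 [b1 bP]] := separating_bits fN.
  have [A [v0 [FA fin0]]] := reaping_constant b0 rF.
  have [B [v1 [FB fin1]]] := reaping_constant (b1 \o e A) rF.
  have [eA einj] := eP _ (Fmem _ FA).
  (* From [n] on, no point of the image of [B] under [e A] is exceptional for either colouring. *)
  have /finite_nat_bound[n nP] : finite_set (A `&` [set m | b0 m <> v0] `|`
      e A @` (B `&` [set k | b1 (e A k) <> v1])).
    by rewrite finite_setU; split; last exact: finite_image.
  exists (g (A, B, n)); split; first by exists (A, B, n).
  have CP m : g (A, B, n) m -> b0 m = v0 /\ b1 m = v1.
    move=> [[k Bk <-] nle]; split; apply: contrapT => bv; apply: nle; apply: nP.
      by left; split.
    by right; exists k.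
  rewrite -subset0 => _ [[m Cm <-] Cfm].
  have [m0 m1] := CP _ Cm; have [fm0 fm1] := CP _ Cfm.
  by apply: (bP m); rewrite ?m0 ?m1.
apply: card_le_trans (card_image_le _ _) _.
have /card_le_fun[s [sF sinj]] := infinite_card_square Finf.
have /infiniteP/card_le_fun[c [cF cinj]] := Finf.
apply/card_le_fun; exists (fun t => s (s t.1, c t.2)); split.
  by move=> [t n] [Ft _]; apply: (sF (_, _)); split; [exact: sF | exact: cF].
move=> [t n] [t' n'] [/= Ft _] [/= Ft' _] E.
have [] := sinj (s t, c n) (s t', c n')
  (conj (sF _ Ft) (cF _ I)) (conj (sF _ Ft') (cF _ I)) E.
by move=> /sinj -> // /cinj ->.
Qed.

(** * From a binary Rosenthal family to a reaping family *)

Lemma reaping_of_binary_rosenthal G : binary_rosenthal G ->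
  exists2 F, reaping F & F #<= G.
Proof.
move=> [Ginf Gros]; apply: contrapT => no.
(* The sets [h A] form a family no larger than [G], hence not reaping if they are infinite, so a
   single [S] splits them all. *)
have /choice[s sP] : forall h : set nat -> set nat, exists S,
    (forall A, G A -> infinite_set (h A)) ->
    forall A, G A -> infinite_set (h A `&` S) /\ infinite_set (h A `\` S).
  move=> h; have [hinf|?] := pselect (forall A, G A -> infinite_set (h A));
    last by exists setT.
  apply: contrapT => noS; apply: no; exists (h @` G); last exact: card_image_le.
  split=> [_ [A GA <-]|[S SP]]; first exact: hinf.
  by apply: noS; exists S => _ A GA; apply: SP; exists A.
(* [s (h k)] is S_k, and [h k A] is the part of [A] inside S_0, ..., S_(k-1). *)
pose fix h (k : nat) : set nat -> set nat :=
  if k is k'.+1 then fun A => h k' A `&` s (h k') else id.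
have h_inf k A : G A -> infinite_set (h k A).
  elim: k A => [|k IH] A GA; first exact: Ginf.
  exact: (sP _ IH _ GA).1.
have hE k A n : h k A n <-> A n /\ forall i, i < k -> s (h i) n.
  elim: k => [|k IH] /=; first by split=> [|[]].
  split=> [[/IH[An sn] skn]|[An sn]].
    by split=> // i; rewrite ltnS leq_eqVlt => /predU1P[->//|]; exact: sn.
  by split; [apply/IH; split=> // i /ltnW; exact: sn | exact: sn].
clearbody h; have /choice[f fP] : forall n, exists m, m <> n /\
    forall k, k <> n -> ~ s (h k) n -> (forall i, i < k -> s (h i) n) -> m = k.
  move=> n.
  have [[k [kn nsk sk]]|no_k] := pselect (exists k, [/\ k <> n,
      ~ s (h k) n & forall i, i < k -> s (h i) n]).
    exists k; split=> // k' _ nsk' sk'; have [lt|lt|//] := ltngtP k k'.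
      by case: nsk; exact: sk'.
    by case: nsk'; exact: sk.
  exists n.+1; split; first by move=> /eqP; rewrite eqn_leq ltnn.
  by move=> k kn nsk sk; case: no_k; exists k.
have [|A [GA fA]] := Gros f; first by move=> n; exact: (fP n).1.
have [k Ak] := infinite_setN0 (Ginf _ GA).
(* Removing [k] ensures [n <> k], so that [f n] really takes the value [k]. *)
have [n [[/hE[An sn] nskn] nk]] := infinite_setN0 (infinite_setD
  (sP _ (h_inf k) _ GA).2 (finite_set1 k)).
rewrite -[False]/(set0 k) -fA; split=> //; exists n => //.
by apply: (fP n).2 => // kn; apply: nk.
Qed.

Theorem theorem4p8 : (ros01 #= reaping_number)%card.
Proof.
have [rG minG] := ros01P; have [rF minF] := reaping_numberP.
have [F rF' leF] := reaping_of_binary_rosenthal rG.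
have [G rG' leG] := binary_rosenthal_of_reaping rF.
rewrite card_eq_le; apply/andP; split.
  exact: card_le_trans (minG _ rG') leG.
exact: card_le_trans (minF _ rF') leF.
Qed.
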